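(* Let $\Pi$ be a uniformly random permutation of $[n]$. Then asymptotically almost surely (i.e. with probability tending to $1$ as $n\to\infty$) \[ bt(\Pi)=(2+o(1))\frac{\log n}{\log\log n}. \]
   Context: Two permutations (sequences of distinct positive integers) $(x_1,\dots,x_k)$ and $(y_1,\dots,y_k)$ are similar if $x_i<x_j \iff y_i<y_j$ for all $1\le i<j\le k$. A block of $\pi$ is a subsequence of $\pi$ whose index set is a segment of consecutive integers. A pair of block twins in $\pi$ is a pair of similar blocks of $\pi$ with disjoint index sets; its length is the length of one of the blocks. $bt(\pi)$ is the largest length of a pair of block twins in $\pi$. *)

(* Defs.v *)
From HB Require Import structures.
From mathcomp Require Import all_boot all_order all_algebra all_fingroup.
From mathcomp Require Import all_classical all_reals all_analysis.
Set Implicit Arguments.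
Unset Strict Implicit.
Unset Printing Implicit Defensive.
Import Order.TTheory GRing.Theory Num.Theory.
Import numFieldNormedType.Exports.
Local Open Scope nat_scope.
Local Open Scope ring_scope.

Definition similar (x y : seq nat) : bool :=
  (size x == size y) &&
  [forall i : 'I_(size x), forall j : 'I_(size x), (i < j)%N ==>
     ((nth 0%N x i < nth 0%N x j)%N == (nth 0%N y i < nth 0%N y j)%N)].

(* The index set of a block of length k is {i, ..., i + k - 1}, with positions
   counted from 0; it lies inside w when i + k <= size w. *)
Definition block_index (i k : nat) : seq nat := iota i k.

Definition block (w : seq nat) (i k : nat) : seq nat :=
  [seq nth 0%N w l | l <- block_index i k].

Definition block_twins (w : seq nat) (i j k : nat) : bool :=
  [&& (i + k <= size w)%N, (j + k <= size w)%N,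
      ~~ has [in block_index i k] (block_index j k)
    & similar (block w i k) (block w j k)].

(* Empty blocks are vacuous twins, so bt w = 0 when w has no nonempty ones. *)
Definition bt (w : seq nat) : nat :=
  \max_(k < (size w).+1 |
        [exists i : 'I_(size w).+1, exists j : 'I_(size w).+1,
           block_twins w i j k]) k.

(* One-line notation, with values in {1, ..., n}. *)
Definition perm_word (n : nat) (s : 'S_n) : seq nat :=
  [seq (s i).+1 | i <- enum 'I_n].

Definition unif_perm_prob (R : realType) (n : nat) (E : pred 'S_n) : R :=
  #|[set s : 'S_n | E s]|%:R / #|[set: 'S_n]|%:R.

Definition aas (R : realType) (E : forall n, pred 'S_n) : Prop :=
  (unif_perm_prob R (E n) @[n --> \oo] --> (1 : R))%classic.

(* Main.v *)
(* Permuting the entries inside one block of length k of a uniform permutation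
   leaves its law and every disjoint block unchanged, and exactly one of the k!
   arrangements makes the block similar to a given disjoint one. Hence two
   disjoint blocks of length k are similar with probability 1/k!, even given any
   event that ignores the order inside one of them.
   Upper bound: a union bound over pairs of positions gives
   P(bt >= k) <= n^2 / k!.
   Lower bound: cut [n] into m = n / k consecutive blocks. Their patterns behave
   as in the birthday problem: if D_t is the event that the first t patterns are
   distinct then P(D_{t+1}) = (1 - t / k!) P(D_t), whence
   P(bt < k) <= P(D_m) <= k! / C(m, 2).
   With w = sqrt (ln (ln n)), a = ln n / ln (ln n) and the thresholds
   k = floor ((2 +- 8 / w) a) + 1, both bounds are at most 1 / w. *)
From mathcomp Require Import all_boot all_order all_algebra all_fingroup.
From mathcomp Require Import all_classical all_reals all_analysis.
From mathcomp Require Import zify ring lra.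
(* [Defs] comes last because [all_algebra] also exports a [similar]. *)
Require Import Defs.
Set Implicit Arguments.
Unset Strict Implicit.
Unset Printing Implicit Defensive.
Import Order.TTheory GRing.Theory Num.Theory.
Import numFieldNormedType.Exports.
Local Open Scope nat_scope.

(** * Ranks, order-matching permutations and double counting *)

Lemma rank_mono (k : nat) (x : 'I_k -> nat) (a b : 'I_k) :
  (#|[set c | x c < x a]| < #|[set c | x c < x b]|) = (x a < x b).
Proof.
have [xab|xba] := ltnP (x a) (x b).
  apply: proper_card; apply/properP; split; last by exists a; rewrite inE ?ltnn.
  by apply/fintype.subsetP => c; rewrite !inE => /ltn_trans; apply.
apply/negbTE; rewrite -leqNgt; apply: subset_leq_card.
by apply/fintype.subsetP => c; rewrite !inE => /leq_trans; apply.
Qed.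

Lemma rank_subproof (k : nat) (x : 'I_k -> nat) (a : 'I_k) :
  #|[set c | x c < x a]| < k.
Proof.
rewrite -[X in _ < X]card_ord -cardsT; apply: proper_card.
by apply/properP; split; [exact: finset.subsetT | exists a; rewrite ?inE ?ltnn].
Qed.

Definition rank (k : nat) (x : 'I_k -> nat) (a : 'I_k) : 'I_k :=
  Ordinal (rank_subproof x a).

Lemma rank_inj (k : nat) (x : 'I_k -> nat) : injective x -> injective (rank x).
Proof.
move=> xI a b /(congr1 val) /= ab; apply: xI.
have := rank_mono x a b; have := rank_mono x b a; rewrite ab ltnn; lia.
Qed.

(** An element of ['I_k] equals the number of elements below it, and [h] maps those below [a] onto
    those below [h a]. *)
Lemma mono_perm_id (k : nat) (h : 'S_k) :
  (forall a b : 'I_k, (a < b) = (h a < h b)) -> forall a, h a = a.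
Proof.
move=> hM a; apply: val_inj => /=.
have cardlt (b : 'I_k) : #|[set c : 'I_k | c < b]| = b.
  rewrite -sum1dep_card -[RHS]card_ord -sum1_card.
  by rewrite (big_ord_widen k (fun=> 1)) // ltnW.
rewrite -[LHS]cardlt -[RHS]cardlt -[RHS](card_imset _ (@perm_inj _ h)).
apply: eq_card => c; rewrite !inE; apply/idP/imsetP => [ch|[d]].
  by exists (h^-1%g c); rewrite ?permKV// inE hM permKV.
by rewrite inE hM => da ->.
Qed.

(** With [p] and [q] the ranks of [x] and [y], the condition makes [p^-1 * h * q] order preserving,
    hence the identity, so [h = p * q^-1] is the only solution. Products act from left to right. *)
Lemma card_order_matching (k : nat) (x y : 'I_k -> nat) :
  injective x -> injective y ->
  #|[set h : 'S_k | [forall a, forall b,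
      (x a < x b) == (y (h a) < y (h b))]]| = 1.
Proof.
move=> xI yI; pose p := perm (rank_inj xI); pose q := perm (rank_inj yI).
have pE a b : (p a < p b) = (x a < x b) by rewrite !permE rank_mono.
have qE a b : (q a < q b) = (y a < y b) by rewrite !permE rank_mono.
apply/eqP/cards1P; exists (p * q^-1)%g; apply/setP => h; rewrite !inE.
apply/idP/eqP => [/forallP hM|->]; last first.
  by do 2 apply/forallP => ?; rewrite -qE !permM !permKV pE.
apply/permP => a; apply: (@perm_inj _ q); rewrite permM permKV.
have : (p^-1 * (h * q))%g (p a) = p a.
  apply: mono_perm_id => b c; rewrite !permM qE.
  have /forallP /(_ (p^-1%g c)) /eqP <- := hM (p^-1%g b).
  by rewrite -pE !permKV.
by rewrite !permM permK.
Qed.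

(* Double counting of the pairs (g, s) with [E (act g s)]. *)
Lemma card_invariant_section (T G : finType) (act : G -> T -> T)
    (E F : pred T) :
  (forall g, injective (act g)) -> (forall g s, F (act g s) = F s) ->
  (forall s, #|[set g | E (act g s)]| = 1) ->
  #|[set s | F s & E s]| * #|G| = #|[set s | F s]|.
Proof.
move=> actI FI E1.
transitivity (\sum_(s | F s) #|[set g | E (act g s)]|); last first.
  by rewrite (eq_bigr (fun=> 1)) // sum1dep_card cardsE.
under eq_bigr do rewrite -sum1dep_card.
rewrite (exchange_big_dep xpredT)//= mulnC -sum_nat_const.
(* For fixed [g], [act g] is a bijection preserving [F], so every [g] contributes the same number of
   pairs. *)
apply: eq_big => // g _; rewrite sum1dep_card -[RHS](card_imset _ (actI g)).
apply: eq_card => s; rewrite inE; apply/idP/imsetP => [/andP[Fs Es]|[r]].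
  exists (invF (actI g) s); rewrite ?f_invF// inE.
  by rewrite f_invF Es -(FI g) f_invF Fs.
by rewrite inE => /andP[Fr Er] ->; rewrite FI Fr Er.
Qed.

(** Lets rearrangements of the [k] places of a block act on all [n] positions. *)
Lemma extend_perm (T U : finType) (c : T -> U) (h : {perm T}) :
  injective c ->
  exists L : {perm U}, (forall a, L (c a) = c (h a)) /\
    (forall x, x \notin codom c -> L x = x).
Proof.
move=> cI; pose f x := if [pick a | c a == x] is Some a then c (h a) else x.
have fc a : f (c a) = c (h a).
  by rewrite /f; case: pickP => [b /eqP/cI->//|/(_ a)]; rewrite eqxx.
have fx x : x \notin codom c -> f x = x.
  rewrite /f; case: pickP => // a /eqP <-.
  by rewrite codom_f.
have fI : injective f.
  move=> x y; have [/codomP[a ->]|xc] := boolP (x \in codom c).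
    have [/codomP[b ->]|yc] := boolP (y \in codom c).
      by rewrite !fc => /cI/perm_inj->.
    by rewrite fc (fx y)// => E; move: yc; rewrite -E codom_f.
  have [/codomP[b ->]|yc] := boolP (y \in codom c).
    by rewrite fc (fx x)// => E; move: xc; rewrite E codom_f.
  by rewrite !fx.
by exists (perm fI); split=> [a|x /fx]; rewrite permE.
Qed.

(** * One-line words, blocks and similarity *)

Lemma size_perm_word (n : nat) (s : 'S_n) : size (perm_word s) = n.
Proof. by rewrite size_map size_enum_ord. Qed.

Lemma nth_perm_word (n : nat) (s : 'S_n) (l : 'I_n) :
  nth 0 (perm_word s) l = (s l).+1.
Proof. by rewrite (nth_map l) ?size_enum_ord// nth_ord_enum. Qed.

Lemma size_block (w : seq nat) (i k : nat) : size (block w i k) = k.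
Proof. by rewrite size_map size_iota. Qed.

Lemma nth_block (w : seq nat) (i k a : nat) :
  a < k -> nth 0 (block w i k) a = nth 0 w (i + a).
Proof. by move=> ak; rewrite (nth_map 0) ?size_iota// nth_iota. Qed.

Lemma similarP (x y : seq nat) :
  reflect (size x = size y /\ forall a b, a < b < size x ->
    (nth 0 x a < nth 0 x b) = (nth 0 y a < nth 0 y b)) (similar x y).
Proof.
apply: (iffP andP) => [[/eqP -> /forallP xy]|[-> xy]]; split => //.
  move=> a b /andP[ab bs]; have sa := ltn_trans ab bs.
  by have /forallP/(_ (Ordinal bs)) := xy (Ordinal sa); rewrite ab => /eqP.
do 2 (apply/forallP => ?); apply/implyP => ab; apply/eqP/xy.
by rewrite ab ltn_ord.
Qed.

Lemma similar_sym (x y : seq nat) : similar x y = similar y x.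
Proof.
by apply/similarP/similarP => -[xy H]; split => // a b ab;
  rewrite H// ?xy// -xy.
Qed.

Lemma similar_trans (y x z : seq nat) :
  similar x y -> similar y z -> similar x z.
Proof.
move=> /similarP[xy H] /similarP[yz H']; apply/similarP.
split=> [|a b ab]; first by rewrite xy.
by rewrite H// H'// -xy.
Qed.

Lemma perm_word_inj (n : nat) (s : 'S_n) (p q : nat) :
  p < n -> q < n -> nth 0 (perm_word s) p = nth 0 (perm_word s) q -> p = q.
Proof.
move=> pn qn; rewrite (nth_perm_word s (Ordinal pn)).
rewrite (nth_perm_word s (Ordinal qn)) => -[] /val_inj/perm_inj.
by move=> /(congr1 val).
Qed.

(** [similar] compares only [a < b]; because the entries are distinct, this also settles [b < a],
    which gives the symmetric form used in [card_order_matching]. *)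
Lemma similar_perm_word (n k i j : nat) (s : 'S_n) :
  i + k <= n -> j + k <= n ->
  similar (block (perm_word s) i k) (block (perm_word s) j k) =
  [forall a : 'I_k, forall b : 'I_k,
     (nth 0 (perm_word s) (i + a) < nth 0 (perm_word s) (i + b)) ==
     (nth 0 (perm_word s) (j + a) < nth 0 (perm_word s) (j + b))].
Proof.
move=> ik jk; apply/similarP/forallP; rewrite !size_block; last first.
  move=> H; split=> // a b /andP[ab bk]; have ak := ltn_trans ab bk.
  rewrite !nth_block//.
  by have /forallP/(_ (Ordinal bk))/eqP := H (Ordinal ak).
move=> [_ H] a; apply/forallP => b; apply/eqP.
have neq p : p + k <= n -> forall a b : 'I_k, a < b ->
    nth 0 (perm_word s) (p + a) <> nth 0 (perm_word s) (p + b).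
  move=> pk c d cd /perm_word_inj; have := ltn_ord d; lia.
have [ab|ba|->] := ltngtP a b; last by rewrite !ltnn.
  by have := H a b; rewrite !nth_block// ab ltn_ord => ->.
have := H b a; rewrite !nth_block// ba ltn_ord => /(_ isT).
have := neq _ ik _ _ ba; have := neq _ jk _ _ ba; lia.
Qed.

(** Similarity has probability [1 / k!] given [F]. Since [F] ignores the entries of the block at
    [j], it survives each rearrangement of that block, and exactly one rearrangement produces
    similarity. *)
Lemma card_similar_blocks (n k i j : nat) (F : pred 'S_n) :
  i + k <= n -> j + k <= n -> (i + k <= j) || (j + k <= i) ->
  (forall s t : 'S_n, (forall l : 'I_n, ~~ (j <= l < j + k) -> s l = t l) ->
     F s = F t) ->
  #|[set s | F s &
      similar (block (perm_word s) i k) (block (perm_word s) j k)]| * k`! =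
  #|[set s | F s]|.
Proof.
move=> ik jk dij FI.
have emb p : p + k <= n -> forall a : 'I_k, p + a < n.
  by move=> pk a; rewrite (leq_trans _ pk)// ltn_add2l.
pose c (a : 'I_k) : 'I_n := Ordinal (emb j jk a).
pose d (a : 'I_k) : 'I_n := Ordinal (emb i ik a).
have cI : injective c by move=> a b /(congr1 val)/= /addnI/val_inj.
have dI : injective d by move=> a b /(congr1 val)/= /addnI/val_inj.
have cN (x : 'I_n) : ~~ (j <= x < j + k) -> x \notin codom c.
  by apply: contra => /codomP[a ->] /=; rewrite leq_addr ltn_add2l ltn_ord.
have dN a : ~~ (j <= d a < j + k) by rewrite /=; have := ltn_ord a; lia.
have [L LP] := choice (fun h : 'S_k => extend_perm h cI).
have Lc h := (LP h).1; have Ln h := (LP h).2.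
rewrite -[k`!]card_Sn.
(* [L h * s] applies [L h] first, so it moves positions and not values. *)
rewrite -(@card_invariant_section _ _ (fun h s => (L h * s)%g)
  (fun s => similar (block (perm_word s) i k) (block (perm_word s) j k)) F).
- by rewrite -cardsT.
- by move=> h; exact: mulgI.
- by move=> h s; apply: FI => l /cN lc; rewrite permM Ln.
move=> s.
rewrite -(@card_order_matching _ (fun a => s (d a)) (fun a => s (c a))).
- apply: eq_card => h; rewrite !inE similar_perm_word//.
  apply: eq_forallb => a; apply: eq_forallb => b.
  rewrite -!/(val (d _)) -!/(val (c _)).
  rewrite (nth_perm_word _ (d a)) (nth_perm_word _ (d b)).
  rewrite (nth_perm_word _ (c a)) (nth_perm_word _ (c b)).
  by rewrite !permM !Lc !(Ln h (d _)) ?cN.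
- by move=> a b /val_inj/perm_inj/dI.
- by move=> a b /val_inj/perm_inj/cI.
Qed.

(** * Block twins and the union bound *)

Lemma block_twinsE (w : seq nat) (i j k : nat) : 0 < k ->
  block_twins w i j k =
  [&& i + k <= size w, j + k <= size w, (i + k <= j) || (j + k <= i)
    & similar (block w i k) (block w j k)].
Proof.
move=> k0; rewrite /block_twins /block_index; congr [&& _, _, _ & _].
rewrite -all_predC; apply/allP/idP => [H|ij x]; last first.
  by rewrite inE !mem_iota; lia.
(* Two intervals of equal length that overlap contain the starting point of one in the other, so
   testing [i] and [j] suffices. *)
have := H j; have := H i; rewrite !inE !mem_iota; lia.
Qed.

Lemma similar_take (x y : seq nat) (k : nat) :
  similar x y -> similar (take k x) (take k y).
Proof.
move=> /similarP[xy H]; apply/similarP; rewrite !size_take xy; split => // a b.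
rewrite -!xy => /andP[ab]; have [kx bk|xk bx] := ltnP k (size x).
  by rewrite !nth_take ?H ?ab ?(ltn_trans bk kx)// (ltn_trans ab bk).
by rewrite !take_oversize -?xy// H// ab.
Qed.

Lemma take_block (w : seq nat) (i k l : nat) :
  k <= l -> take k (block w i l) = block w i k.
Proof. by move=> kl; rewrite -map_take take_iota (minn_idPl kl). Qed.

Lemma leq_bt (w : seq nat) (i j k : nat) : 0 < k ->
  block_twins w i j k -> k <= bt w.
Proof.
move=> k0 bij; have := bij; rewrite block_twinsE// => /and4P[ik jk _ _].
have kw : k < (size w).+1 by lia.
have iw : i < (size w).+1 by lia.
have jw : j < (size w).+1 by lia.
rewrite /bt (leq_bigmax_cond (Ordinal kw))//.
by apply/existsP; exists (Ordinal iw); apply/existsP; exists (Ordinal jw).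
Qed.

(** Longer twins may be cut to their first [k] entries, which stay similar and disjoint. *)
Lemma bt_ge_twins (w : seq nat) (k : nat) : 0 < k -> k <= bt w ->
  [exists i : 'I_(size w), exists j : 'I_(size w), block_twins w i j k].
Proof.
move=> k0; apply: contraTT => H; rewrite -ltnNge -(prednK k0) ltnS.
apply/bigmax_leqP => l /existsP[i /existsP[j]].
have [//|kl] := leqP l k.-1; rewrite block_twinsE; last by lia.
move=> /and4P[il jl ij sij]; case/negP: H.
have iw : i < size w by lia.
have jw : j < size w by lia.
apply/existsP; exists (Ordinal iw); apply/existsP; exists (Ordinal jw) => /=.
have kl' : k <= l by lia.
rewrite block_twinsE//; apply/and4P; split; try lia.
by rewrite -(take_block w i kl') -(take_block w j kl') similar_take.
Qed.

Lemma card_bigcup_le (I T : finType) (A : I -> {set T}) :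
  #|\bigcup_i A i| <= \sum_i #|A i|.
Proof.
elim/big_rec2: _ => [|i m U _ IH]; first by rewrite cards0.
by rewrite (leq_trans (leq_card_setU _ _))// leq_add2l.
Qed.

(** Divided by [n! * k!], this is the bound [n^2 / k!] on the probability. *)
Lemma card_bt_ge (n k : nat) : 0 < k ->
  #|[set s : 'S_n | k <= bt (perm_word s)]| * k`! <= n ^ 2 * n`!.
Proof.
move=> k0; pose E (ij : 'I_n * 'I_n) (s : 'S_n) :=
  block_twins (perm_word s) ij.1 ij.2 k.
have Ecard ij : #|[set s | E ij s]| * k`! <= n`!.
  have [/and3P[ik jk dij]|H] := boolP [&& ij.1 + k <= n, ij.2 + k <= n
      & (ij.1 + k <= ij.2) || (ij.2 + k <= ij.1)]; last first.
    (* Positions that overlap or run past the end carry no twins. *)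
    rewrite (_ : [set s | E ij s] = finset.set0) ?cards0//.
    apply/setP => s; rewrite !inE /E block_twinsE// size_perm_word.
    by apply: contraNF H => /and4P[-> -> ->].
  rewrite -(_ : #|[set s : 'S_n | xpredT s]| = n`!); last first.
    by rewrite cardsE card_Sn.
  rewrite -(@card_similar_blocks n k ij.1 ij.2 xpredT)//.
  rewrite leq_mul2r; apply/orP; right; apply: subset_leq_card.
  by apply/fintype.subsetP => s; rewrite !inE /E block_twinsE// => /and4P[].
have : \sum_ij #|[set s | E ij s]| * k`! <= n ^ 2 * n`!.
  rewrite (leq_trans (leq_sum _ (fun ij _ => Ecard ij)))//.
  by rewrite sum_nat_const card_prod card_ord mulnn.
apply: leq_trans; rewrite -big_distrl leq_mul2r; apply/orP; right.
apply: leq_trans (card_bigcup_le (fun ij => [set s | E ij s])).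
apply: subset_leq_card; apply/fintype.subsetP => s; rewrite inE => /bt_ge_twins.
rewrite size_perm_word => /(_ k0)/existsP[i /existsP[j Eij]].
by apply/bigcupP; exists (i, j); rewrite ?inE.
Qed.

(** * The birthday argument for consecutive blocks *)

Definition distinct_patterns (k t : nat) (w : seq nat) : bool :=
  [forall b : 'I_t, forall a : 'I_t, (a < b) ==>
     ~~ similar (block w (a * k) k) (block w (b * k) k)].

Lemma distinct_patternsP (k t : nat) (w : seq nat) :
  reflect (forall a b, a < b < t ->
             ~~ similar (block w (a * k) k) (block w (b * k) k))
          (distinct_patterns k t w).
Proof.
apply: (iffP forallP) => [H a b /andP[ab bt]|H b].
  have /forallP/(_ (Ordinal (ltn_trans ab bt))) := H (Ordinal bt).
  by rewrite ab.
by apply/forallP => a; apply/implyP => ab; rewrite H// ab ltn_ord.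
Qed.

(** The recursion [P(D_{t+1}) <= (1 - t / k!) P(D_t)], without subtraction. Given [D_t], the next
    block matches each of the [t] earlier ones with probability [1 / k!], and these events exclude
    one another. *)
Lemma card_distinct_patternsS (n k t : nat) : t.+1 * k <= n ->
  #|[set s : 'S_n | distinct_patterns k t.+1 (perm_word s)]| * k`! +
  t * #|[set s : 'S_n | distinct_patterns k t (perm_word s)]| <=
  #|[set s : 'S_n | distinct_patterns k t (perm_word s)]| * k`!.
Proof.
move=> tkn; pose D u (s : 'S_n) := distinct_patterns k u (perm_word s).
rewrite -/(D t) -/(D t.+1).
pose E (a : nat) (s : 'S_n) :=
  similar (block (perm_word s) (a * k) k) (block (perm_word s) (t * k) k).
have DI (s s' : 'S_n) :
    (forall l : 'I_n, ~~ (t * k <= l < t * k + k) -> s l = s' l) ->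
    D t s = D t s'.
  move=> ss'; apply: eq_forallb => b; apply: eq_forallb => a.
  suff bE (c : 'I_t) :
      block (perm_word s) (c * k) k = block (perm_word s') (c * k) k.
    by rewrite !bE.
  apply/eq_in_map => l; rewrite mem_iota => /andP[_ lc].
  have ck : c * k + k <= t * k by rewrite -mulSnr leq_mul2r ltn_ord orbT.
  have ln : l < n by rewrite mulSnr in tkn; lia.
  rewrite (nth_perm_word s (Ordinal ln)) (nth_perm_word s' (Ordinal ln)).
  by rewrite ss'//=; lia.
have EC (a : 'I_t) : #|[set s | D t s & E a s]| * k`! = #|[set s | D t s]|.
  have ak : a * k + k <= t * k by rewrite -mulSnr leq_mul2r ltn_ord orbT.
  rewrite mulSnr in tkn; apply: card_similar_blocks => //; first lia.
  by rewrite ak.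
have -> : t * #|[set s | D t s]| =
    (\sum_(a < t) #|[set s | D t s & E a s]|) * k`!.
  by rewrite big_distrl /= (eq_bigr _ (fun a _ => EC a)) sum_nat_const card_ord.
(* After cancelling [k!], the inequality is checked for each [s] separately: [D t.+1] and the
   matches [E a] together count at most once, and only under [D t]. *)
rewrite -mulnDl leq_mul2r; apply/orP; right; rewrite -!sum1dep_card.
under [X in _ + X]eq_bigr do rewrite -sum1dep_card big_mkcondr.
rewrite exchange_big /= big_mkcond [X in _ + X <= _]big_mkcond.
rewrite [X in _ <= X]big_mkcond -big_split leq_sum// => s _ /=.
rewrite -/(D t.+1 s) -/(D t s).
have DS : D t.+1 s -> D t s.
  move=> /distinct_patternsP H; apply/distinct_patternsP => a b ab.
  by apply: H; lia.
have [Dt|/negbTE Dt] := boolP (D t s); last first.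
  by case: ifP => // /DS; rewrite Dt.
have [/existsP[a Ea]|/existsPn NE] := boolP [exists a : 'I_t, E a s];
  last first.
  rewrite big1 => [|a _]; first by rewrite addn0; case: ifP.
  by rewrite (negbTE (NE a)).
have -> : D t.+1 s = false.
  apply/negbTE/negP => /distinct_patternsP/(_ a t).
  by rewrite ltn_ord ltnS leqnn -/(E a s) Ea => /(_ isT).
(* A second match [b] would make blocks [a] and [b] similar by transitivity, against [D t]. *)
rewrite (bigD1 a)//= Ea big1 ?addn0// => b ba; case: ifP => // Eb.
have {}Ea : similar (block (perm_word s) (t * k) k)
  (block (perm_word s) (a * k) k) by rewrite similar_sym.
have Eba := similar_trans Eb Ea.
move/distinct_patternsP : Dt => Dt; have [ab|ab|/val_inj ab] := ltngtP a b.
- by have := Dt a b; rewrite ab ltn_ord similar_sym Eba => /(_ isT).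
- by have := Dt b a; rewrite ab ltn_ord Eba => /(_ isT).
- by rewrite ab eqxx in ba.
Qed.

(** Solves the recursion in the form [P(D_t) <= k! / (k! + C(t, 2))], which is stable under
    induction. *)
Lemma card_distinct_patterns (n k t : nat) : t * k <= n ->
  #|[set s : 'S_n | distinct_patterns k t (perm_word s)]| *
    (k`! + 'C(t, 2)) <= k`! * n`!.
Proof.
elim: t => [_|t IH tk].
  by rewrite addn0 mulnC leq_mul2l -[X in _ <= X]card_Sn max_card orbT.
have {}IH := IH (leq_trans (leq_mul (leqnSn t) (leqnn k)) tk).
have := card_distinct_patternsS tk.
rewrite binS bin1; have := fact_gt0 k.
set x := #|_|; set y := #|_| in IH *; move: IH.
move: ('C(t, 2)) (k`!) (n`!) x y => c f N x y H f0 H1.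
(* With [f = k!] and [c = 'C(t, 2)], the reason is [(f - t) * (f + c + t) <= f * (f + c)]. *)
nia.
Qed.

(** Two of the [m] consecutive blocks with the same pattern would be twins of length [k]. *)
Lemma card_bt_lt (n k m : nat) : 0 < k -> m * k <= n ->
  #|[set s : 'S_n | bt (perm_word s) < k]| * 'C(m, 2) <= k`! * n`!.
Proof.
move=> k0 mk; apply: leq_trans (card_distinct_patterns mk).
apply: leq_mul (leq_addl _ _); apply: subset_leq_card.
apply/fintype.subsetP => s; rewrite !inE => btk.
apply/distinct_patternsP => a b /andP[ab bm].
apply: contraTN btk => sab; rewrite -leqNgt.
apply: (@leq_bt _ (a * k) (b * k)) => //.
have ak : a * k + k <= b * k by rewrite -mulSnr leq_mul2r ab orbT.
have bk : b * k + k <= m * k by rewrite -mulSnr leq_mul2r bm orbT.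
by rewrite block_twinsE// size_perm_word sab ak; apply/and4P; split => //; lia.
Qed.

(** * Factorial estimates at the two thresholds *)

Local Open Scope ring_scope.

Lemma expR_gid (R : realType) (x : R) : x <= expR x.
Proof. by rewrite (le_trans _ (expR_ge1Dx x))// lerDr. Qed.

(** [k^k / k!] is one term of the exponential series at [k]. *)
Lemma pow_le_fact_expR (R : realType) (k : nat) :
  (k%:R : R) ^+ k <= k`!%:R * expR k%:R.
Proof.
case: k => [|k]; first by rewrite expr0 fact0 mul1r expR0.
rewrite -ler_pdivrMl ?ltr0n ?fact_gt0// mulrC.
by have := @expR_ge1Dxn R k.+1%:R k (ler0n _ _); lra.
Qed.

Lemma fact_le_pow (k : nat) : (k`! <= k ^ k)%N.
Proof.
rewrite fact_prod -[X in (_ <= _ ^ X)%N]card_ord -prod_nat_const.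
rewrite big_add1 big_mkord.
by apply: leq_prod => i _; exact: ltn_ord.
Qed.

(* In the next four lemmas [L = ln n], [w ^+ 2 = ln (ln n)] and
   [a = ln n / ln (ln n)]. *)
Lemma expR_le_ratio (R : realType) (w a L : R) :
  10 <= w -> L = expR (w ^+ 2) -> a * w ^+ 2 = L ->
  expR (w ^+ 2 - 2 * w + 2) <= a.
Proof.
move=> w10 LE aE; have w0 : 0 < w by lra.
have E : expR (w ^+ 2 - 2 * w + 2) = L * (expR (w - 1)) ^- 2.
  by rewrite LE -exprVn -expRN -expRM_natl -expRD; congr expR; ring.
(* This replaces the divisor [w^2] in [a = L / w^2] by the larger [exp (2 w - 2)]. *)
have ew : w <= expR (w - 1) by have := expR_ge1Dx (w - 1); lra.
have a0 : 0 <= a.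
  have : 0 <= a * w ^+ 2 by rewrite aE LE expR_ge0.
  by rewrite pmulr_lge0 ?exprn_gt0.
rewrite E -aE ler_pdivrMr ?exprn_gt0 ?expR_gt0// ler_wpM2l//.
by rewrite lerXn2r ?nnegrE ?expR_ge0// ltW.
Qed.

Lemma ratio_ge (R : realType) (w a L : R) :
  10 <= w -> L = expR (w ^+ 2) -> a * w ^+ 2 = L -> w <= a.
Proof.
move=> w10 LE aE; apply: le_trans (expR_le_ratio w10 LE aE).
apply: le_trans (expR_ge1Dx _); rewrite expr2; nra.
Qed.

(** From [k! >= (k / e)^k] and [ln k >= w^2 - 2 w + 2], [k!] is at least [exp ((w^2 - 2 w) k)]. In
    the exponent the slack [8 / w] gains [8 a w], which outweighs the loss [4 a w] due to
    [- 2 w]. *)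
Lemma fact_above_threshold (R : realType) (w a L : R) (k : nat) :
  10 <= w -> L = expR (w ^+ 2) -> a * w ^+ 2 = L ->
  (2 + 8 / w) * a < k%:R ->
  w * expR L ^+ 2 <= k`!%:R.
Proof.
move=> w10 LE aE ak; have w0 : 0 < w by lra.
have aw := ratio_ge w10 LE aE; have a0 : 0 < a by lra.
have d0 : 0 < 8 / w by rewrite divr_gt0.
have dw : 8 / w * w = 8 by rewrite divfK// gt_eqF.
have ak' : expR (w ^+ 2 - 2 * w + 2) <= k%:R.
  by apply: le_trans (expR_le_ratio w10 LE aE) _; nra.
have : expR ((w ^+ 2 - 2 * w) * k%:R) <= k`!%:R.
  rewrite -(ler_pM2r (expR_gt0 (k%:R : R))).
  rewrite (le_trans _ (pow_le_fact_expR R k))//.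
  rewrite -expRD -[X in _ + X]mul1r -mulrDl expRM_natr.
  rewrite lerXn2r ?nnegrE ?expR_ge0// (le_trans _ ak')// ler_expR; lra.
apply: le_trans.
rewrite (le_trans (ler_wpM2r _ (expR_gid w))) ?exprn_ge0 ?expR_ge0//.
rewrite -expRM_natl -expRD ler_expR.
have w2 : 0 <= w ^+ 2 - 2 * w by rewrite expr2; nra.
apply: le_trans (ler_wpM2l w2 (ltW ak)).
have -> : (w ^+ 2 - 2 * w) * ((2 + 8 / w) * a) = 2 * L + 4 * a * w - 16 * a.
  rewrite -aE; move: dw; set d := 8 / w => dw.
  have -> : (w ^+ 2 - 2 * w) * ((2 + d) * a) =
    2 * (a * w ^+ 2) + (d * w) * w * a - 4 * w * a - 2 * (d * w) * a by ring.
  by rewrite dw; ring.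
nra.
Qed.

(** Here [k <= L] gives [k! <= L^k = exp (w^2 k)], while the number of blocks is about
    [n / k >= exp (L - w^2)]. The slack [8 / w] saves [8 a w] in the first exponent, enough to
    absorb the terms in [w^2] and the factor [w]. *)
Lemma fact_below_threshold (R : realType) (w a L : R) (k n : nat) :
  10 <= w -> L = expR (w ^+ 2) -> a * w ^+ 2 = L ->
  n%:R = expR L -> (0 < k)%N -> k%:R <= (2 - 8 / w) * a + 1 ->
  w * k`!%:R <= 'C((n %/ k)%N, 2)%:R.
Proof.
move=> w10 LE aE nE k0 ka; have w0 : 0 < w by lra.
have aw := ratio_ge w10 LE aE; have a0 : 0 < a by lra.
have d0 : 0 < 8 / w by rewrite divr_gt0.
have dw : 8 / w * w = 8 by rewrite divfK// gt_eqF.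
have ww : 100 <= w ^+ 2 by rewrite expr2; nra.
have La : 100 * a <= L by rewrite -aE; nra.
have Lw : w ^+ 2 + 3 <= L by rewrite -aE; nra.
have kL : k%:R <= L by nra.
have L0 : 0 < L by lra.
have factk : k`!%:R <= expR (2 * L - 8 * w * a + w ^+ 2).
  apply: (@le_trans _ _ ((k ^ k)%:R)); first by rewrite ler_nat fact_le_pow.
  have Lk : (k ^ k)%:R <= L ^+ k.
    by rewrite natrX lerXn2r ?nnegrE ?ler0n ?(ltW L0).
  rewrite (le_trans Lk)// [X in X ^+ k]LE -expRM_natr ler_expR.
  apply: (le_trans (ler_wpM2l (sqr_ge0 w) ka)).
  rewrite -aE; move: dw; set d := 8 / w => dw.
  have -> : w ^+ 2 * ((2 - d) * a + 1) =
    2 * (a * w ^+ 2) - (d * w) * w * a + w ^+ 2 by ring.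
  by rewrite dw.
have x4 : 4 <= expR (L - w ^+ 2).
  by apply: le_trans (expR_ge1Dx _); lra.
have xm : expR (L - w ^+ 2) <= (n %/ k)%N%:R + 1.
  rewrite expRD expRN -LE -nE ler_pdivrMr// natr1.
  apply: (@le_trans _ _ (((n %/ k).+1 * k)%N%:R)).
    by rewrite ler_nat ltnW// ltn_ceil.
  by rewrite natrM ler_wpM2l.
have -> : 'C((n %/ k)%N, 2)%:R = (n %/ k)%N%:R * ((n %/ k)%N%:R - 1) / 2 :> R.
  have : ((n %/ k) * (n %/ k).-1)%N%:R = 2 * 'C((n %/ k)%N, 2)%:R :> R.
    by rewrite -(natrM _ 2) -mul_bin_diag bin1.
  case: (n %/ k)%N => [|m]; first by rewrite bin0n !mul0r.
  by rewrite natrM /= -(natr1 m) => H; lra.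
(* With [x = exp (L - w^2) >= 4] and at least [x - 1] blocks, [(x - 1) (x - 2) / 2 >= x^2 / 8]. *)
apply: (@le_trans _ _ (expR (L - w ^+ 2) ^+ 2 / 8)); last first.
  by rewrite expr2; nra.
rewrite ler_pdivlMr// (le_trans (ler_wpM2r _ (ler_wpM2l _ factk)))//; first lra.
rewrite mulrAC.
have H : w * 8 <= expR (8 * w * a - 3 * w ^+ 2).
  by apply: le_trans (expR_gid _); rewrite expr2; nra.
apply: (le_trans (ler_wpM2r _ H)); first exact: expR_ge0.
rewrite -expRM_natl -expRD ler_expR; lra.
Qed.

(** * Concentration and passage to the limit *)

Lemma unif_perm_prob_le1 (R : realType) (n : nat) (E : pred 'S_n) :
  unif_perm_prob R E <= 1.
Proof.
by rewrite ler_pdivrMr ?ltr0n ?cardsT ?card_Sn ?fact_gt0// mul1r ler_nat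
  -card_Sn max_card.
Qed.

(** The complement of [E] lies in the union of [A] and [B], each of probability at most [1 / w]. *)
Lemma unif_perm_prob_ge (R : realType) (n : nat) (w : R) (E A B : pred 'S_n) :
  0 < w -> (forall s, [|| E s, A s | B s]) ->
  w * #|[set s | A s]|%:R <= n`!%:R -> w * #|[set s | B s]|%:R <= n`!%:R ->
  1 - 2 / w <= unif_perm_prob R E.
Proof.
move=> w0 cover wA wB.
have f0 : 0 < n`!%:R :> R by rewrite ltr0n fact_gt0.
rewrite /unif_perm_prob cardsT card_Sn ler_pdivlMr//.
have H : n`!%:R <=
    #|[set s | E s]|%:R + #|[set s | A s]|%:R + #|[set s | B s]|%:R :> R.
  rewrite -!natrD ler_nat -card_Sn -cardsT.
  rewrite (_ : finset.setT = [set s | E s] :|: [set s | A s] :|: [set s | B s]).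
    rewrite (leq_trans (leq_card_setU _ _))// leq_add2r.
    exact: (leq_trans (leq_card_setU _ _)).
  by apply/setP => s; rewrite !inE -orbA cover.
rewrite -(ler_pM2l w0); have -> : w * ((1 - 2 / w) * n`!%:R) = (w - 2) * n`!%:R.
  by rewrite mulrA mulrBr mulr1 mulrCA divff ?mulr1// gt_eqF.
have : w * n`!%:R <=
    w * (#|[set s | E s]|%:R + #|[set s | A s]|%:R + #|[set s | B s]|%:R).
  by rewrite ler_pM2l.
rewrite !mulrDr; lra.
Qed.

Lemma bt_concentration (R : realType) (n : nat) (w : R) :
  10 <= w -> ln (ln (n%:R : R)) = w ^+ 2 ->
  1 - 2 / w <= unif_perm_prob R (fun s : 'S_n =>
    let a : R := ln (n%:R : R) / ln (ln (n%:R : R)) in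
    `| (bt (perm_word s))%:R - 2 * a | <= 8 / w * a).
Proof.
move=> w10 wE; have w0 : 0 < w by lra.
have w20 : 0 < w ^+ 2 by rewrite exprn_gt0.
(* [ln] is [0] on nonpositive reals, so [w^2 > 0] forces [ln n > 0], and then [n > 0]. *)
have L0 : 0 < ln (n%:R : R).
  by rewrite ltNge; apply/negP => /ln0 L0; rewrite -wE L0 ltxx in w20.
have n0 : 0 < (n%:R : R).
  by rewrite ltNge; apply/negP => /ln0 n0; rewrite n0 ltxx in L0.
have LE : ln (n%:R : R) = expR (w ^+ 2) by rewrite -wE lnK.
have nE : n%:R = expR (ln (n%:R : R)) by rewrite lnK.
have aE : ln (n%:R : R) / ln (ln (n%:R : R)) * w ^+ 2 = ln (n%:R : R).
  by rewrite wE divfK// gt_eqF.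
move: aE; set a := ln _ / _ => aE.
have aw := ratio_ge w10 LE aE; have a0 : 0 < a by lra.
have d0 : 0 < 8 / w by rewrite divr_gt0.
(* Keeps the lower threshold nonnegative, so that [Num.trunc] is its floor. *)
have d1 : 8 / w <= 1 by rewrite ler_pdivrMr//; lra.
(* The successors make [ku] and [kl] positive and strictly above the thresholds: [bt < ku] and
   [bt >= kl] give the two sides of the estimate. *)
pose ku := (Num.trunc ((2 + 8 / w) * a)).+1.
pose kl := (Num.trunc ((2 - 8 / w) * a)).+1.
apply: (@unif_perm_prob_ge _ _ _ _ (fun s => ku <= bt (perm_word s))%N
  (fun s => bt (perm_word s) < kl)%N) => //.
- move=> s; rewrite /= -/a ler_distl.
  have [//|ub] := leqP ku _; first by rewrite orbT.
  have [//|lb] := ltnP _ kl; first by rewrite !orbT.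
  rewrite !orbF; apply/andP; split.
    have : (2 - 8 / w) * a <= (bt (perm_word s))%:R.
      by apply: le_trans (ltW (truncnS_gt _)) _; rewrite ler_nat.
    by lra.
  have : (bt (perm_word s))%:R <= (2 + 8 / w) * a.
    rewrite ltnS in ub.
    rewrite (@le_trans _ _ (Num.trunc ((2 + 8 / w) * a))%:R)//.
      by rewrite ler_nat.
    by rewrite truncn_le// mulr_ge0; lra.
  lra.
- have := @fact_above_threshold R w a _ ku w10 LE aE (truncnS_gt _).
  rewrite -nE => H; have := @card_bt_ge n ku isT.
  rewrite -(ler_nat R) natrM [X in _ <= X]natrM natrX => H'.
  have n20 : 0 < (n%:R : R) ^+ 2 by rewrite exprn_gt0.
  rewrite -(ler_pM2l n20) (le_trans _ H')// mulrCA mulrA mulrC.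
  by rewrite ler_wpM2l.
- have ka : kl%:R <= (2 - 8 / w) * a + 1.
    by rewrite /kl -(natr1 (Num.trunc _)) lerD2r truncn_le// mulr_ge0; lra.
  have H := @fact_below_threshold R w a _ kl n w10 LE aE nE isT ka.
  have := @card_bt_lt n kl (n %/ kl)%N isT (leq_divM _ _).
  rewrite -(ler_nat R) natrM [X in _ <= X]natrM => H'.
  have f0 : 0 < kl`!%:R :> R by rewrite ltr0n fact_gt0.
  rewrite -(ler_pM2l f0) (le_trans _ H')// mulrCA mulrA mulrC.
  by rewrite ler_wpM2l.
Qed.

Local Open Scope classical_set_scope.

Lemma near_loglog (R : realType) (B : R) :
  \forall n \near \oo, B <= Num.sqrt (ln (ln (n%:R : R))).
Proof.
near=> n; have [B0|B0] := ltP B 0.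
  by rewrite (le_trans (ltW B0)) ?sqrtr_ge0.
have Bn : expR (expR (B ^+ 2)) <= (n%:R : R).
  by near: n; exact: nbhs_infty_ger.
have n0 : 0 < (n%:R : R) by apply: lt_le_trans Bn; exact: expR_gt0.
have Bl : expR (B ^+ 2) <= ln (n%:R : R) by rewrite -ler_expR lnK.
have l0 : 0 < ln (n%:R : R) by apply: lt_le_trans Bl; exact: expR_gt0.
have Bll : B ^+ 2 <= ln (ln (n%:R : R)) by rewrite -ler_expR lnK.
by rewrite -(ger0_norm B0) -sqrtr_sqr ler_wsqrtr.
Unshelve. all: by end_near. Qed.

Theorem theorem3p5 (R : realType) :
  exists2 delta : nat -> R, delta n @[n --> \oo] --> (0 : R) &
    aas R (fun (n : nat) (s : 'S_n) =>
      let a : R := ln (n%:R : R) / ln (ln (n%:R : R)) in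
      `| (bt (perm_word s))%:R - 2 * a | <= delta n * a).
Proof.
pose w n : R := Num.sqrt (ln (ln (n%:R : R))).
have small (c : R) : 0 < c -> forall e, 0 < e ->
    \forall n \near \oo, 10 <= w n /\ c / w n <= e.
  move=> c0 e e0; near=> n.
  have w10 : 10 <= w n by near: n; exact: near_loglog.
  split => //; rewrite ler_pdivrMr; last lra.
  by rewrite mulrC -ler_pdivrMr//; near: n; exact: near_loglog.
(* The relative error of [bt_concentration], which vanishes because [w] tends to infinity. *)
exists (fun n => 8 / w n).
  apply/cvgrPdist_le => e e0; near=> n.
  have [w10 we] : 10 <= w n /\ 8 / w n <= e by near: n; exact: small.
  by rewrite sub0r normrN ger0_norm// divr_ge0//; lra.
apply/cvgrPdist_le => e e0; near=> n.
have [w10 we] : 10 <= w n /\ 2 / w n <= e by near: n; exact: small.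
(* The square root is [0] on negative reals, so [w n >= 10] ensures that squaring recovers
   [ln (ln n)]. *)
have wE : ln (ln (n%:R : R)) = w n ^+ 2.
  rewrite sqr_sqrtr// ltW// ltNge; apply/negP => /ler0_sqrtr w0.
  by move: w10; rewrite /w w0; lra.
have := bt_concentration w10 wE => H.
rewrite ger0_norm ?subr_ge0 ?unif_perm_prob_le1//; lra.
Unshelve. all: by end_near. Qed.
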